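(* Let $T=(T,\eta,\mu)$ be a monad on a category $\mathbf{C}$ with finite products $(\times,1)$ and finite coproducts $(+,0)$. The following are equivalent. (i) $T$ is additive. (ii) The coproducts in $\mathbf{C}$ form biproducts in the Kleisli category $\mathcal{K}\ell(T)$. (iii) The products in $\mathbf{C}$ yield biproducts in the category $\mathrm{Alg}(T)$ of Eilenberg–Moore algebras of $T$.
   Context: Kleisli category: objects are those of $\mathbf{C}$, morphisms $X\to Y$ are maps $X\to T(Y)$ in $\mathbf{C}$, composition is $g\bullet f=\mu\circ T(g)\circ f$. The functor $J:\mathbf{C}\to\mathcal{K}\ell(T)$, $J(X)=X$, $J(f)=\eta\circ f$, preserves finite coproducts, so $(+,0)$ with coprojections $J(\kappa_i)$ are finite coproducts in $\mathcal{K}\ell(T)$. In $\mathrm{Alg}(T)$ the finite products are the standard ones: the final object is the unique algebra on $1$, and the product of $\alpha:T(X)\to X$ and $\beta:T(Y)\to Y$ is $\langle\alpha\circ T(\pi_1),\beta\circ T(\pi_2)\rangle:T(X\times Y)\to X\times Y$, with projections $\pi_1,\pi_2$. Additive monad: suppose $T(0)$ is final, $T(0)\cong 1$. The zero map is $0_{X,Y}=\big(X\xrightarrow{!}1\cong T(0)\xrightarrow{T(!)}T(Y)\big)$. Put $p_1=[\eta,0_{Y,X}]:X+Y\to T(X)$, $p_2=[0_{X,Y},\eta]:X+Y\to T(Y)$ and $$\mathsf{bc}=\langle\mu\circ T(p_1),\mu\circ T(p_2)\rangle:T(X+Y)\to T(X)\times T(Y).$$ The monad $T$ is called additive if $T(0)\cong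 1$ and $\mathsf{bc}$ is an isomorphism for all $X,Y$. A category has biproducts if it has a zero object $0$ (both initial and final) and for any objects $A_1,A_2$ an object $A_1\oplus A_2$ which is both a product with projections $\pi_i:A_1\oplus A_2\to A_i$ and a coproduct with coprojections $\kappa_i:A_i\to A_1\oplus A_2$, such that $\pi_j\circ\kappa_i=\mathrm{id}_{A_i}$ if $i=j$, and $\pi_j\circ\kappa_i$ is the zero map $A_i\to 0\to A_j$ if $i\neq j$. Statement (ii) means: $0$ is a zero object of $\mathcal{K}\ell(T)$ and each coproduct $X+Y$ with coprojections $J(\kappa_1),J(\kappa_2)$ can be equipped with projections in $\mathcal{K}\ell(T)$ making it a biproduct. Statement (iii) means: $1$ is a zero object of $\mathrm{Alg}(T)$ and each product of algebras, with its projections, can be equipped with coprojections in $\mathrm{Alg}(T)$ making it a biproduct. *)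

(* Defs.v *)
From Stdlib Require Import ProofIrrelevance.

Set Implicit Arguments.
Unset Strict Implicit.
Unset Printing Implicit Defensive.

Declare Scope cat_scope.
Delimit Scope cat_scope with cat.
Local Open Scope cat_scope.

Record category := Category {
  ob :> Type;
  hom : ob -> ob -> Type;
  idc : forall X, hom X X;
  comp : forall X Y Z, hom Y Z -> hom X Y -> hom X Z;
  comp_idl : forall X Y (f : hom X Y), comp (idc Y) f = f;
  comp_idr : forall X Y (f : hom X Y), comp f (idc X) = f;
  comp_assoc : forall X Y Z W (h : hom Z W) (g : hom Y Z) (f : hom X Y),
    comp h (comp g f) = comp (comp h g) f
}.
Arguments hom {c} X Y.
Arguments idc {c} X.
Arguments comp {c X Y Z} g f.

Notation "g ∘ f" := (comp g f) (at level 40, left associativity) : cat_scope.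

Definition is_iso (C : category) (X Y : C) (f : hom X Y) : Prop :=
  exists g : hom Y X, g ∘ f = idc X /\ f ∘ g = idc Y.

Definition is_initial (C : category) (Z : C) : Prop :=
  forall X : C, exists! f : hom Z X, True.

Definition is_final (C : category) (Z : C) : Prop :=
  forall X : C, exists! f : hom X Z, True.

Definition is_zero_object (C : category) (Z : C) : Prop :=
  is_initial Z /\ is_final Z.

Definition is_product (C : category) (A1 A2 P : C)
    (p1 : hom P A1) (p2 : hom P A2) : Prop :=
  forall (X : C) (f : hom X A1) (g : hom X A2),
    exists! h : hom X P, p1 ∘ h = f /\ p2 ∘ h = g.

Definition is_coproduct (C : category) (A1 A2 S : C)
    (k1 : hom A1 S) (k2 : hom A2 S) : Prop :=
  forall (X : C) (f : hom A1 X) (g : hom A2 X),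
    exists! h : hom S X, h ∘ k1 = f /\ h ∘ k2 = g.

(* Meant for a zero object [Z]: the two factors [A -> Z -> B] are then unique,
   so this says that [f] is the zero map. *)
Definition is_zero_map (C : category) (Z A B : C) (f : hom A B) : Prop :=
  exists (a : hom A Z) (b : hom Z B), f = b ∘ a.

(* [S] with the given maps is a biproduct of [A1] and [A2], relative to the
   zero object [Z]. *)
Definition is_biproduct (C : category) (Z A1 A2 S : C)
    (p1 : hom S A1) (p2 : hom S A2) (k1 : hom A1 S) (k2 : hom A2 S) : Prop :=
  is_zero_object Z /\
  is_product p1 p2 /\ is_coproduct k1 k2 /\
  p1 ∘ k1 = idc A1 /\ p2 ∘ k2 = idc A2 /\
  is_zero_map Z (p2 ∘ k1) /\ is_zero_map Z (p1 ∘ k2).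

Record finite_products (C : category) := FiniteProducts {
  one : C;
  bang : forall X : C, hom X one;
  bang_unique : forall (X : C) (f : hom X one), f = bang X;
  prod_ob : C -> C -> C;
  pr1 : forall X Y, hom (prod_ob X Y) X;
  pr2 : forall X Y, hom (prod_ob X Y) Y;
  pair : forall Z X Y : C, hom Z X -> hom Z Y -> hom Z (prod_ob X Y);
  pr1_pair : forall (Z X Y : C) (f : hom Z X) (g : hom Z Y),
    pr1 X Y ∘ pair f g = f;
  pr2_pair : forall (Z X Y : C) (f : hom Z X) (g : hom Z Y),
    pr2 X Y ∘ pair f g = g;
  pair_unique : forall (Z X Y : C) (h : hom Z (prod_ob X Y)),
    h = pair (pr1 X Y ∘ h) (pr2 X Y ∘ h)
}.
Arguments pair {C} _ {Z X Y} _ _.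

Record finite_coproducts (C : category) := FiniteCoproducts {
  zero : C;
  cobang : forall X : C, hom zero X;
  cobang_unique : forall (X : C) (f : hom zero X), f = cobang X;
  sum_ob : C -> C -> C;
  in1 : forall X Y, hom X (sum_ob X Y);
  in2 : forall X Y, hom Y (sum_ob X Y);
  copair : forall X Y Z : C, hom X Z -> hom Y Z -> hom (sum_ob X Y) Z;
  copair_in1 : forall (X Y Z : C) (f : hom X Z) (g : hom Y Z),
    copair f g ∘ in1 X Y = f;
  copair_in2 : forall (X Y Z : C) (f : hom X Z) (g : hom Y Z),
    copair f g ∘ in2 X Y = g;
  copair_unique : forall (X Y Z : C) (h : hom (sum_ob X Y) Z),
    h = copair (h ∘ in1 X Y) (h ∘ in2 X Y)
}.
Arguments copair {C} _ {X Y Z} _ _.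

Record functor (C D : category) := Functor {
  fobj :> C -> D;
  fmap : forall X Y : C, hom X Y -> hom (fobj X) (fobj Y);
  fmap_id : forall X : C, fmap (idc X) = idc (fobj X);
  fmap_comp : forall (X Y Z : C) (g : hom Y Z) (f : hom X Y),
    fmap (g ∘ f) = fmap g ∘ fmap f
}.
Arguments fmap {C D} _ {X Y} _.

Record monad (C : category) := Monad {
  mfun :> functor C C;
  eta : forall X : C, hom X (mfun X);
  mu : forall X : C, hom (mfun (mfun X)) (mfun X);
  eta_nat : forall (X Y : C) (f : hom X Y), eta Y ∘ f = fmap mfun f ∘ eta X;
  mu_nat : forall (X Y : C) (f : hom X Y),
    mu Y ∘ fmap mfun (fmap mfun f) = fmap mfun f ∘ mu X;
  mu_eta : forall X : C, mu X ∘ eta (mfun X) = idc (mfun X);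
  mu_fmap_eta : forall X : C, mu X ∘ fmap mfun (eta X) = idc (mfun X);
  mu_assoc : forall X : C, mu X ∘ mu (mfun X) = mu X ∘ fmap mfun (mu X)
}.

Section Kleisli.
Variables (C : category) (T : monad C).

Definition kleisli_hom (X Y : C) : Type := hom X (T Y).

Definition kleisli_comp (X Y Z : C)
    (g : kleisli_hom Y Z) (f : kleisli_hom X Y) : kleisli_hom X Z :=
  mu T Z ∘ fmap T g ∘ f.

Lemma kleisli_idl (X Y : C) (f : kleisli_hom X Y) :
  kleisli_comp (eta T Y) f = f.
Proof. unfold kleisli_comp. now rewrite mu_fmap_eta, comp_idl. Qed.

Lemma kleisli_idr (X Y : C) (f : kleisli_hom X Y) :
  kleisli_comp f (eta T X) = f.
Proof.
unfold kleisli_comp.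
now rewrite <- comp_assoc, <- eta_nat, comp_assoc, mu_eta, comp_idl.
Qed.

Lemma kleisli_assoc (X Y Z W : C)
    (h : kleisli_hom Z W) (g : kleisli_hom Y Z) (f : kleisli_hom X Y) :
  kleisli_comp h (kleisli_comp g f) = kleisli_comp (kleisli_comp h g) f.
Proof.
unfold kleisli_comp.
rewrite !fmap_comp, !comp_assoc, <- mu_assoc.
now rewrite <- (comp_assoc (mu T W) (mu T (T W))), mu_nat, comp_assoc.
Qed.

Definition kleisli : category :=
  Category kleisli_idl kleisli_idr kleisli_assoc.

Definition kleisli_J_map (X Y : C) (f : hom X Y) : @hom kleisli X Y :=
  eta T Y ∘ f.

Lemma kleisli_J_id (X : C) : kleisli_J_map (idc X) = @idc kleisli X.
Proof. exact (comp_idr (eta T X)). Qed.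

Lemma kleisli_J_comp (X Y Z : C) (g : hom Y Z) (f : hom X Y) :
  kleisli_J_map (g ∘ f) = @comp kleisli X Y Z (kleisli_J_map g) (kleisli_J_map f).
Proof.
unfold kleisli_J_map; simpl; unfold kleisli_comp.
now rewrite fmap_comp, !comp_assoc, mu_fmap_eta, comp_idl, <- eta_nat.
Qed.

Definition kleisli_J : functor C kleisli :=
  @Functor C kleisli (fun X => X) kleisli_J_map kleisli_J_id kleisli_J_comp.

End Kleisli.

Section Algebras.
Variables (C : category) (T : monad C).

Record algebra := Algebra {
  carrier : C;
  act : hom (T carrier) carrier;
  act_eta : act ∘ eta T carrier = idc carrier;
  act_mu : act ∘ mu T carrier = act ∘ fmap T act
}.

Record alg_hom (A B : algebra) := AlgHom {
  alg_map : hom (carrier A) (carrier B);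
  alg_map_act : alg_map ∘ act A = act B ∘ fmap T alg_map
}.

Lemma alg_hom_eq (A B : algebra) (f g : alg_hom A B) :
  alg_map f = alg_map g -> f = g.
Proof.
destruct f as [f Hf], g as [g Hg]; simpl; intros e; subst g.
now rewrite (proof_irrelevance _ Hf Hg).
Qed.

Lemma alg_id_act (A : algebra) :
  idc (carrier A) ∘ act A = act A ∘ fmap T (idc (carrier A)).
Proof. now rewrite fmap_id, comp_idl, comp_idr. Qed.

Definition alg_id (A : algebra) : alg_hom A A := AlgHom (alg_id_act A).

Lemma alg_comp_act (A B D : algebra) (g : alg_hom B D) (f : alg_hom A B) :
  (alg_map g ∘ alg_map f) ∘ act A = act D ∘ fmap T (alg_map g ∘ alg_map f).
Proof.
now rewrite fmap_comp, <- comp_assoc, alg_map_act, comp_assoc, alg_map_act,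
  <- comp_assoc.
Qed.

Definition alg_comp (A B D : algebra) (g : alg_hom B D) (f : alg_hom A B) :
  alg_hom A D := AlgHom (alg_comp_act g f).

Lemma alg_idl (A B : algebra) (f : alg_hom A B) : alg_comp (alg_id B) f = f.
Proof. apply alg_hom_eq, comp_idl. Qed.

Lemma alg_idr (A B : algebra) (f : alg_hom A B) : alg_comp f (alg_id A) = f.
Proof. apply alg_hom_eq, comp_idr. Qed.

Lemma alg_assoc (A B D E : algebra)
    (h : alg_hom D E) (g : alg_hom B D) (f : alg_hom A B) :
  alg_comp h (alg_comp g f) = alg_comp (alg_comp h g) f.
Proof. apply alg_hom_eq, comp_assoc. Qed.

Definition Alg : category := Category alg_idl alg_idr alg_assoc.

Variable P : finite_products C.

Lemma bang_eq (X : C) (f g : hom X (one P)) : f = g.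
Proof. now rewrite (bang_unique f), (bang_unique g). Qed.

Lemma pair_ext (Z X Y : C) (f g : hom Z (prod_ob P X Y)) :
  pr1 P X Y ∘ f = pr1 P X Y ∘ g -> pr2 P X Y ∘ f = pr2 P X Y ∘ g -> f = g.
Proof.
now intros e1 e2; rewrite (pair_unique f), (pair_unique g), e1, e2.
Qed.

Definition one_alg : Alg :=
  @Algebra (one P) (bang P (T (one P))) (bang_eq _ _) (bang_eq _ _).

Section Product.
Variables A B : algebra.

Definition prod_act :
    hom (T (prod_ob P (carrier A) (carrier B)))
        (prod_ob P (carrier A) (carrier B)) :=
  pair P (act A ∘ fmap T (pr1 P (carrier A) (carrier B)))
         (act B ∘ fmap T (pr2 P (carrier A) (carrier B))).

Lemma pr1_act :
  pr1 P (carrier A) (carrier B) ∘ prod_act =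
  act A ∘ fmap T (pr1 P (carrier A) (carrier B)).
Proof. apply pr1_pair. Qed.

Lemma pr2_act :
  pr2 P (carrier A) (carrier B) ∘ prod_act =
  act B ∘ fmap T (pr2 P (carrier A) (carrier B)).
Proof. apply pr2_pair. Qed.

Lemma prod_act_eta :
  prod_act ∘ eta T _ = idc (prod_ob P (carrier A) (carrier B)).
Proof.
apply pair_ext; rewrite comp_assoc, ?pr1_act, ?pr2_act, comp_idr.
- now rewrite <- comp_assoc, <- eta_nat, comp_assoc, act_eta, comp_idl.
- now rewrite <- comp_assoc, <- eta_nat, comp_assoc, act_eta, comp_idl.
Qed.

Lemma prod_act_mu : prod_act ∘ mu T _ = prod_act ∘ fmap T prod_act.
Proof.
apply pair_ext; rewrite !comp_assoc, ?pr1_act, ?pr2_act, <- !comp_assoc,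
  <- mu_nat, <- fmap_comp, ?pr1_act, ?pr2_act, fmap_comp, !comp_assoc.
- now rewrite act_mu.
- now rewrite act_mu.
Qed.

Definition prod_alg : Alg := Algebra prod_act_eta prod_act_mu.

Definition alg_pr1 : @hom Alg prod_alg A := @AlgHom prod_alg A _ pr1_act.
Definition alg_pr2 : @hom Alg prod_alg B := @AlgHom prod_alg B _ pr2_act.

End Product.
End Algebras.

Section Additive.
Variables (C : category) (P : finite_products C) (S : finite_coproducts C).
Variable T : monad C.

(* [u] is the isomorphism [1 -> T 0] through which the zero maps factor; it is
   the only map of that type once [T 0] is final. *)
Definition zero_map (u : hom (one P) (T (zero S))) (X Y : C) : hom X (T Y) :=
  fmap T (cobang S Y) ∘ u ∘ bang P X.

Definition bc_p1 (u : hom (one P) (T (zero S))) (X Y : C) :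
    hom (sum_ob S X Y) (T X) :=
  copair S (eta T X) (zero_map u Y X).

Definition bc_p2 (u : hom (one P) (T (zero S))) (X Y : C) :
    hom (sum_ob S X Y) (T Y) :=
  copair S (zero_map u X Y) (eta T Y).

Definition bc (u : hom (one P) (T (zero S))) (X Y : C) :
    hom (T (sum_ob S X Y)) (prod_ob P (T X) (T Y)) :=
  pair P (mu T X ∘ fmap T (bc_p1 u X Y)) (mu T Y ∘ fmap T (bc_p2 u X Y)).

Definition additive : Prop :=
  exists u : hom (one P) (T (zero S)),
    is_iso u /\ forall X Y : C, is_iso (bc u X Y).

Definition kleisli_biproducts : Prop :=
  is_zero_object (C := kleisli T) (zero S) /\
  forall X Y : C,
    exists (p1 : @hom (kleisli T) (sum_ob S X Y) X)
           (p2 : @hom (kleisli T) (sum_ob S X Y) Y),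
      is_biproduct (C := kleisli T) (zero S) p1 p2
        (fmap (kleisli_J T) (in1 S X Y)) (fmap (kleisli_J T) (in2 S X Y)).

Definition alg_biproducts : Prop :=
  is_zero_object (one_alg T P) /\
  forall A B : Alg T,
    exists (k1 : hom A (prod_alg P A B)) (k2 : hom B (prod_alg P A B)),
      is_biproduct (one_alg T P) (alg_pr1 P A B) (alg_pr2 P A B) k1 k2.

End Additive.

(* Main.v *)
(** All three conditions say that [1] is isomorphic to [T 0] and that the maps
    [bc] are isomorphisms.  In the Kleisli category, a map into the product of
    [X] and [Y] is a map of [C] into [T X * T Y], and [bc] is the comparison
    with maps into [T (X + Y)].  In [Alg T], [T (X + Y)] is the coproduct of the
    free algebras [T X] and [T Y], and [bc] is the comparison from it to their
    product.  So [bc] is invertible iff the product of free algebras is a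
    biproduct.  This extends to arbitrary algebras [A] and [B] because
    [T A * T B -> A * B] is a coequalizer in [Alg T] that splits in [C]. *)

Require Import Defs.

Set Implicit Arguments.
Unset Strict Implicit.
Unset Printing Implicit Defensive.

Local Open Scope cat_scope.

(** * Zero objects, zero maps and biproducts in an arbitrary category *)

Section Categories.
Variable C : category.

Lemma initial_eq (Z X : C) (f g : hom Z X) : is_initial Z -> f = g.
Proof.
intros HZ; destruct (HZ X) as [h [_ Hh]].
now rewrite <- (Hh f I), (Hh g I).
Qed.

Lemma final_eq (Z X : C) (f g : hom X Z) : is_final Z -> f = g.
Proof.
intros HZ; destruct (HZ X) as [h [_ Hh]].
now rewrite <- (Hh f I), (Hh g I).
Qed.

Lemma initial_iso (Z W : C) (m : hom Z W) :
  is_iso m -> is_initial Z -> is_initial W.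
Proof.
intros [n [_ mn]] HZ X; destruct (HZ X) as [h _].
exists (h ∘ n); split; [trivial|]; intros g _.
rewrite <- (comp_idr g), <- mn, comp_assoc.
now rewrite (initial_eq h (g ∘ m) HZ).
Qed.

Lemma final_iso (Z W : C) (m : hom Z W) :
  is_iso m -> is_final Z -> is_final W.
Proof.
intros [n [_ mn]] HZ X; destruct (HZ X) as [h _].
exists (m ∘ h); split; [trivial|]; intros g _.
rewrite <- (comp_idl g), <- mn, <- comp_assoc.
now rewrite (final_eq h (n ∘ g) HZ).
Qed.

Lemma initial_initial_iso (Z W : C) (m : hom Z W) :
  is_initial Z -> is_initial W -> is_iso m.
Proof.
intros HZ HW; destruct (HW Z) as [n _].
exists n; split; now apply initial_eq.
Qed.

Lemma final_final_iso (Z W : C) (m : hom Z W) :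
  is_final Z -> is_final W -> is_iso m.
Proof.
intros HZ HW; destruct (HZ W) as [n _].
exists n; split; now apply final_eq.
Qed.

Lemma zero_map_eq (Z X Y : C) (f g : hom X Y) :
  is_zero_object Z -> is_zero_map Z f -> is_zero_map Z g -> f = g.
Proof.
intros [HI HF] [a [b ->]] [a' [b' ->]].
now rewrite (initial_eq b b' HI), (final_eq a a' HF).
Qed.

Lemma is_zero_map_compl (Z X Y W : C) (g : hom Y W) (f : hom X Y) :
  is_zero_map Z f -> is_zero_map Z (g ∘ f).
Proof. intros [a [b ->]]; exists a, (g ∘ b); apply comp_assoc. Qed.

Lemma is_zero_map_compr (Z X Y W : C) (g : hom Y W) (f : hom X Y) :
  is_zero_map Z g -> is_zero_map Z (g ∘ f).
Proof. intros [a [b ->]]; exists (a ∘ f), b; symmetry; apply comp_assoc. Qed.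

Lemma product_eq (A B P X : C) (p1 : hom P A) (p2 : hom P B) (f g : hom X P) :
  is_product p1 p2 -> p1 ∘ f = p1 ∘ g -> p2 ∘ f = p2 ∘ g -> f = g.
Proof.
intros HP e1 e2; destruct (HP X (p1 ∘ g) (p2 ∘ g)) as [h [_ Hh]].
now rewrite <- (Hh f (conj e1 e2)), (Hh g (conj eq_refl eq_refl)).
Qed.

Lemma coproduct_eq (A B S X : C) (k1 : hom A S) (k2 : hom B S)
    (f g : hom S X) :
  is_coproduct k1 k2 -> f ∘ k1 = g ∘ k1 -> f ∘ k2 = g ∘ k2 -> f = g.
Proof.
intros HS e1 e2; destruct (HS X (g ∘ k1) (g ∘ k2)) as [h [_ Hh]].
now rewrite <- (Hh f (conj e1 e2)), (Hh g (conj eq_refl eq_refl)).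
Qed.

Lemma coproduct_iso (A B S R : C) (k1 : hom A S) (k2 : hom B S) (m : hom S R) :
  is_iso m -> is_coproduct k1 k2 -> is_coproduct (m ∘ k1) (m ∘ k2).
Proof.
intros [n [nm mn]] HS X f g; destruct (HS X f g) as [h [[h1 h2] _]].
exists (h ∘ n); split.
- now rewrite !comp_assoc, <- (comp_assoc h), nm, comp_idr.
- intros h' [h1' h2'].
  assert (e : h = h' ∘ m).
  { apply (coproduct_eq HS); rewrite <- comp_assoc; congruence. }
  now rewrite e, <- comp_assoc, mn, comp_idr.
Qed.

Lemma coproduct_coproduct_iso (A B S R : C) (k1 : hom A S) (k2 : hom B S)
    (m : hom S R) :
  is_coproduct k1 k2 -> is_coproduct (m ∘ k1) (m ∘ k2) -> is_iso m.
Proof.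
intros HS HR; destruct (HR S k1 k2) as [n [[n1 n2] _]].
exists n; split.
- apply (coproduct_eq HS); now rewrite <- comp_assoc, comp_idl.
- apply (coproduct_eq HR); now rewrite <- comp_assoc, ?n1, ?n2, comp_idl.
Qed.

(** The equational part of [is_biproduct], split off from the universal properties because, over a
    product and a zero object, it already determines the coprojections. *)
Definition biproduct_equations (Z A1 A2 S : C)
    (p1 : hom S A1) (p2 : hom S A2) (k1 : hom A1 S) (k2 : hom A2 S) : Prop :=
  p1 ∘ k1 = idc A1 /\ p2 ∘ k2 = idc A2 /\
  is_zero_map Z (p2 ∘ k1) /\ is_zero_map Z (p1 ∘ k2).

(** The coprojections are the pairings [⟨id, 0⟩] and [⟨0, id⟩]. *)
Lemma exists_biproduct_equations (Z A B P : C) (p1 : hom P A) (p2 : hom P B) :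
  is_zero_object Z -> is_product p1 p2 ->
  exists k1 k2, biproduct_equations Z p1 p2 k1 k2.
Proof.
intros [HI HF] HP.
destruct (HI A) as [ia _], (HI B) as [ib _], (HF A) as [fa _], (HF B) as [fb _].
destruct (HP A (idc A) (ib ∘ fa)) as [k1 [[e1 e2] _]].
destruct (HP B (ia ∘ fb) (idc B)) as [k2 [[e3 e4] _]].
exists k1, k2; repeat split; trivial.
- now exists fa, ib.
- now exists fb, ia.
Qed.

(** Both sides have the same components under [q1] and [q2]: the diagonal ones reduce to [f] or [g],
    and the off-diagonal ones are zero maps, which are unique. *)
Lemma biproduct_equations_natural (Z A B P A' B' P' : C)
    (p1 : hom P A) (p2 : hom P B) (k1 : hom A P) (k2 : hom B P)
    (q1 : hom P' A') (q2 : hom P' B') (l1 : hom A' P') (l2 : hom B' P')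
    (f : hom A A') (g : hom B B') (m : hom P P') :
  is_zero_object Z -> is_product q1 q2 ->
  biproduct_equations Z p1 p2 k1 k2 -> biproduct_equations Z q1 q2 l1 l2 ->
  q1 ∘ m = f ∘ p1 -> q2 ∘ m = g ∘ p2 -> m ∘ k1 = l1 ∘ f /\ m ∘ k2 = l2 ∘ g.
Proof.
intros HZ HQ [k11 [k22 [k21 k12]]] [l11 [l22 [l21 l12]]] m1 m2.
split; apply (product_eq HQ); rewrite !comp_assoc, ?m1, ?m2, <- comp_assoc.
- now rewrite k11, l11, comp_idl, comp_idr.
- apply (zero_map_eq HZ);
    [now apply is_zero_map_compl | now apply is_zero_map_compr].
- apply (zero_map_eq HZ);
    [now apply is_zero_map_compl | now apply is_zero_map_compr].
- now rewrite k22, l22, comp_idl, comp_idr.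
Qed.

(** This is naturality for the identity maps. *)
Lemma biproduct_equations_unique (Z A B P : C) (p1 : hom P A) (p2 : hom P B)
    (k1 l1 : hom A P) (k2 l2 : hom B P) :
  is_zero_object Z -> is_product p1 p2 ->
  biproduct_equations Z p1 p2 k1 k2 -> biproduct_equations Z p1 p2 l1 l2 ->
  k1 = l1 /\ k2 = l2.
Proof.
intros HZ HP Hk Hl.
rewrite <- (comp_idl k1), <- (comp_idl k2), <- (comp_idr l1), <- (comp_idr l2).
apply (biproduct_equations_natural HZ HP Hk Hl); now rewrite comp_idl, comp_idr.
Qed.

(** A Yoneda argument: the preimage of [idc Y] is a right inverse of [m], and injectivity at [X]
    makes it a left inverse. *)
Lemma iso_of_bijective_post (X Y : C) (m : hom X Y) :
  (forall (Z : C) (f : hom Z Y), exists! h : hom Z X, m ∘ h = f) -> is_iso m.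
Proof.
intros H; destruct (H Y (idc Y)) as [n [mn _]].
destruct (H X m) as [h [_ Hh]].
exists n; split; [|exact mn].
rewrite <- (Hh (n ∘ m)), <- (Hh (idc X)); trivial.
- apply comp_idr.
- now rewrite comp_assoc, mn, comp_idl.
Qed.

End Categories.

(** * Free algebras and the forgetful functor from [Alg T] *)

Section Algebras.
Variables (C : category) (T : monad C).

Definition free_alg (X : C) : Alg T :=
  Algebra (mu_eta T X) (mu_assoc T X).

Lemma free_ext_act (X : C) (A : Alg T) (f : hom X (carrier A)) :
  (act A ∘ fmap T f) ∘ mu T X = act A ∘ fmap T (act A ∘ fmap T f).
Proof.
now rewrite <- comp_assoc, <- mu_nat, comp_assoc, act_mu, fmap_comp, comp_assoc.
Qed.

(** The transpose of [f] under the free-forgetful adjunction. *)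
Definition free_ext (X : C) (A : Alg T) (f : hom X (carrier A)) :
    hom (free_alg X) A :=
  @AlgHom C T (free_alg X) A (act A ∘ fmap T f) (free_ext_act f).

Lemma free_ext_eta (X : C) (A : Alg T) (f : hom X (carrier A)) :
  alg_map (free_ext f) ∘ eta T X = f.
Proof.
simpl; now rewrite <- comp_assoc, <- eta_nat, comp_assoc, act_eta, comp_idl.
Qed.

(** Since [mu ∘ T eta] is the identity, a homomorphism [h] out of a free algebra is recovered as
    [act A ∘ T (h ∘ eta)]. *)
Lemma free_hom_eq (X : C) (A : Alg T) (f g : hom (free_alg X) A) :
  alg_map f ∘ eta T X = alg_map g ∘ eta T X -> f = g.
Proof.
intros e; apply alg_hom_eq.
assert (H : forall h : hom (T X) (carrier A),
  h ∘ mu T X = act A ∘ fmap T h -> h = act A ∘ fmap T (h ∘ eta T X)).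
{ intros h Hh.
  now rewrite fmap_comp, comp_assoc, <- Hh, <- comp_assoc, mu_fmap_eta, comp_idr. }
rewrite (H _ (alg_map_act f)), (H _ (alg_map_act g)).
exact (f_equal (fun h => act A ∘ fmap T h) e).
Qed.

Lemma free_map_act (X Y : C) (f : hom X Y) :
  fmap T f ∘ mu T X = mu T Y ∘ fmap T (fmap T f).
Proof. symmetry; apply mu_nat. Qed.

Definition free_map (X Y : C) (f : hom X Y) : hom (free_alg X) (free_alg Y) :=
  @AlgHom C T (free_alg X) (free_alg Y) (fmap T f) (free_map_act f).

(** The counit of the free-forgetful adjunction at [A]. *)
Definition act_hom (A : Alg T) : hom (free_alg (carrier A)) A :=
  @AlgHom C T (free_alg (carrier A)) A (act A) (act_mu A).

(** In [C] the map [act A] has the section [eta], and homomorphisms are determined by their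
    underlying maps. *)
Lemma act_hom_epi (A B : Alg T) (f g : hom A B) :
  f ∘ act_hom A = g ∘ act_hom A -> f = g.
Proof.
intros e; apply alg_hom_eq.
rewrite <- (comp_idr (alg_map f)), <- (comp_idr (alg_map g)), <- (act_eta A).
rewrite !comp_assoc; f_equal; exact (f_equal (@alg_map _ _ _ _) e).
Qed.

(** The inverse in [C] respects the actions: insert [T f ∘ T g = id] after [act B] and move [f]
    across the action, where it cancels against [g]. *)
Lemma alg_iso (A B : Alg T) (f : hom A B) : is_iso (alg_map f) -> is_iso f.
Proof.
intros [g [gf fg]].
assert (Hg : g ∘ act B = act A ∘ fmap T g).
{ rewrite <- (comp_idr (act B)), <- fmap_id, <- fg, fmap_comp.
  now rewrite (comp_assoc (act B)), <- alg_map_act, !comp_assoc, gf, comp_idl. }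
now exists (AlgHom Hg); split; apply alg_hom_eq.
Qed.

Lemma alg_map_iso (A B : Alg T) (f : hom A B) : is_iso f -> is_iso (alg_map f).
Proof.
intros [g [gf fg]]; exists (alg_map g); split.
- exact (f_equal (@alg_map _ _ _ _) gf).
- exact (f_equal (@alg_map _ _ _ _) fg).
Qed.

(** * The free algebra functor preserves finite coproducts *)

Section FreeCoproducts.
Variable S : finite_coproducts C.

Lemma cobang_eq (X : C) (f g : hom (zero S) X) : f = g.
Proof. now rewrite (cobang_unique f), (cobang_unique g). Qed.

Lemma copair_ext (X Y Z : C) (f g : hom (sum_ob S X Y) Z) :
  f ∘ in1 S X Y = g ∘ in1 S X Y -> f ∘ in2 S X Y = g ∘ in2 S X Y -> f = g.
Proof.
now intros e1 e2; rewrite (copair_unique f), (copair_unique g), e1, e2.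
Qed.

Lemma free_zero_initial : is_initial (free_alg (zero S)).
Proof.
intros A; exists (free_ext (cobang S (carrier A))); split; [trivial|].
intros g _; apply free_hom_eq, cobang_eq.
Qed.

Lemma free_coproduct (X Y : C) :
  is_coproduct (free_map (in1 S X Y)) (free_map (in2 S X Y)).
Proof.
intros A f g.
set (f' := alg_map f ∘ eta T X); set (g' := alg_map g ∘ eta T Y).
exists (free_ext (A := A) (copair S f' g')); split.
- split; apply free_hom_eq; simpl.
  + now rewrite <- (comp_assoc (act A)), <- fmap_comp, copair_in1,
      <- comp_assoc, <- eta_nat, comp_assoc, act_eta, comp_idl.
  + now rewrite <- (comp_assoc (act A)), <- fmap_comp, copair_in2,
      <- comp_assoc, <- eta_nat, comp_assoc, act_eta, comp_idl.
- intros h [h1 h2]; apply free_hom_eq; rewrite free_ext_eta; unfold f', g'.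
  rewrite <- h1, <- h2; simpl; apply copair_ext.
  + now rewrite copair_in1, <- !comp_assoc, eta_nat.
  + now rewrite copair_in2, <- !comp_assoc, eta_nat.
Qed.

End FreeCoproducts.

(** * Products of algebras and their split presentation by free algebras *)

Variable P : finite_products C.

Lemma one_alg_final : is_final (one_alg T P).
Proof.
intros A.
exists (@AlgHom C T A (one_alg T P) (bang P (carrier A)) (bang_eq _ _)).
split; [trivial|]; intros g _; apply alg_hom_eq, bang_eq.
Qed.

Lemma alg_product (A B : Alg T) : is_product (alg_pr1 P A B) (alg_pr2 P A B).
Proof.
intros X f g.
assert (H : pair P (alg_map f) (alg_map g) ∘ act X =
  prod_act P A B ∘ fmap T (pair P (alg_map f) (alg_map g))).
{ apply (@pair_ext C P); rewrite !comp_assoc, ?pr1_pair, ?pr2_pair, ?pr1_act,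
    ?pr2_act, <- comp_assoc, <- fmap_comp, ?pr1_pair, ?pr2_pair;
    apply alg_map_act. }
exists (@AlgHom C T X (prod_alg P A B) _ H); split.
- split; apply alg_hom_eq; [apply pr1_pair | apply pr2_pair].
- intros h [h1 h2]; apply alg_hom_eq; simpl; rewrite <- h1, <- h2; simpl.
  symmetry; apply pair_unique.
Qed.

Lemma alg_prod_map (A B A' B' : Alg T) (f : hom A A') (g : hom B B') :
  exists m : hom (prod_alg P A B) (prod_alg P A' B'),
    alg_pr1 P A' B' ∘ m = f ∘ alg_pr1 P A B /\
    alg_pr2 P A' B' ∘ m = g ∘ alg_pr2 P A B.
Proof.
destruct (alg_product (f ∘ alg_pr1 P A B) (g ∘ alg_pr2 P A B)) as [m [Hm _]].
now exists m.
Qed.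

Lemma alg_map_comp_eq (A B B' D : Alg T)
    (g : hom B D) (f : hom A B) (g' : hom B' D) (f' : hom A B') :
  g ∘ f = g' ∘ f' -> alg_map g ∘ alg_map f = alg_map g' ∘ alg_map f'.
Proof. intros e; exact (f_equal (@alg_map _ _ _ _) e). Qed.

(** The section [s] is only a map of [C], yet [H ∘ s] is a homomorphism: inserting [T m ∘ T s = id]
    before [act A] lets [m] cross the action, and there [H ∘ s ∘ m] collapses to the homomorphism
    [H]. *)
Lemma alg_factor_split (A A' D : Alg T) (m : hom A' A)
    (s : hom (carrier A) (carrier A')) (H : hom A' D) :
  alg_map m ∘ s = idc (carrier A) -> alg_map H ∘ s ∘ alg_map m = alg_map H ->
  exists h : hom A D, h ∘ m = H.
Proof.
intros ms Hsm.
assert (Hh : (alg_map H ∘ s) ∘ act A = act D ∘ fmap T (alg_map H ∘ s)).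
{ rewrite <- (comp_idr (act A)), <- fmap_id, <- ms, (fmap_comp T (alg_map m)).
  now rewrite (comp_assoc (act A)), <- alg_map_act, !comp_assoc, Hsm,
    alg_map_act, <- comp_assoc, <- fmap_comp. }
exists (AlgHom Hh); apply alg_hom_eq; exact Hsm.
Qed.

(** The map [eta × eta] of [C], which provides the splitting; it is not assumed to respect the
    actions. *)
Definition prod_unit (A B : Alg T) :
    hom (prod_ob P (carrier A) (carrier B))
        (prod_ob P (T (carrier A)) (T (carrier B))) :=
  pair P (eta T (carrier A) ∘ pr1 P _ _) (eta T (carrier B) ∘ pr2 P _ _).

Lemma prod_unit_section (A B : Alg T)
    (m : hom (prod_alg P (free_alg (carrier A)) (free_alg (carrier B)))
             (prod_alg P A B)) :
  alg_pr1 P A B ∘ m = act_hom A ∘ alg_pr1 P _ _ ->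
  alg_pr2 P A B ∘ m = act_hom B ∘ alg_pr2 P _ _ ->
  alg_map m ∘ prod_unit A B = idc (prod_ob P (carrier A) (carrier B)).
Proof.
intros m1 m2.
apply alg_map_comp_eq in m1; apply alg_map_comp_eq in m2; simpl in m1, m2.
unfold prod_unit; apply (@pair_ext C P); rewrite comp_assoc, comp_idr; simpl.
- now rewrite m1, <- comp_assoc, pr1_pair, comp_assoc, act_eta, comp_idl.
- now rewrite m2, <- comp_assoc, pr2_pair, comp_assoc, act_eta, comp_idl.
Qed.

(** With [m] being [act × act] and [n] being [T act × T act], this is naturality of [eta] at the two
    actions, componentwise. *)
Lemma prod_unit_natural (A B : Alg T)
    (m : hom (prod_alg P (free_alg (carrier A)) (free_alg (carrier B)))
             (prod_alg P A B))
    (n : hom (prod_alg P (free_alg (T (carrier A))) (free_alg (T (carrier B))))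
             (prod_alg P (free_alg (carrier A)) (free_alg (carrier B)))) :
  alg_pr1 P A B ∘ m = act_hom A ∘ alg_pr1 P _ _ ->
  alg_pr2 P A B ∘ m = act_hom B ∘ alg_pr2 P _ _ ->
  alg_pr1 P _ _ ∘ n = free_map (act A) ∘ alg_pr1 P _ _ ->
  alg_pr2 P _ _ ∘ n = free_map (act B) ∘ alg_pr2 P _ _ ->
  prod_unit A B ∘ alg_map m =
  alg_map n ∘ prod_unit (free_alg (carrier A)) (free_alg (carrier B)).
Proof.
intros m1 m2 n1 n2.
apply alg_map_comp_eq in m1; apply alg_map_comp_eq in m2; simpl in m1, m2.
apply alg_map_comp_eq in n1; apply alg_map_comp_eq in n2; simpl in n1, n2.
unfold prod_unit; apply (@pair_ext C P); simpl.
- rewrite !comp_assoc, pr1_pair, n1, <- !comp_assoc, m1, pr1_pair.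
  now rewrite !comp_assoc, eta_nat.
- rewrite !comp_assoc, pr2_pair, n2, <- !comp_assoc, m2, pr2_pair.
  now rewrite !comp_assoc, eta_nat.
Qed.

(** When [one_alg] is a zero object exactly one pair [k1], [k2] satisfies the equations, so
    quantifying over all pairs avoids choosing one. *)
Definition prod_coproduct (A B : Alg T) : Prop :=
  forall (k1 : hom A (prod_alg P A B)) (k2 : hom B (prod_alg P A B)),
    biproduct_equations (one_alg T P) (alg_pr1 P A B) (alg_pr2 P A B) k1 k2 ->
    is_coproduct k1 k2.

(* The algebra [A * B] is the coequalizer of [mu * mu] and [T act * T act] from
   [T (T A) * T (T B)] to [T A * T B], split in [C] by [eta * eta]. *)
Lemma prod_coproduct_of_free :
  is_zero_object (one_alg T P) ->
  (forall X Y : C, prod_coproduct (free_alg X) (free_alg Y)) ->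
  forall A B : Alg T, prod_coproduct A B.
Proof.
intros HZ HF A B k1 k2 Hk.
set (FA := free_alg (carrier A)); set (FB := free_alg (carrier B)).
set (FFA := free_alg (T (carrier A))); set (FFB := free_alg (T (carrier B))).
destruct (exists_biproduct_equations HZ (alg_product (A := FA) (B := FB)))
  as [l1 [l2 Hl]].
destruct (exists_biproduct_equations HZ (alg_product (A := FFA) (B := FFB)))
  as [j1 [j2 Hj]].
assert (Cl : is_coproduct l1 l2) by exact (HF _ _ _ _ Hl).
assert (Cj : is_coproduct j1 j2) by exact (HF _ _ _ _ Hj).
(* The quotient map [m] is [act × act]; the parallel pair is [d], that is [mu × mu], and [n], that
   is [T act × T act]. *)
destruct (alg_prod_map (A := FA) (B := FB) (A' := A) (B' := B)
  (act_hom A) (act_hom B)) as [m [m1 m2]].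
destruct (alg_prod_map (A := FFA) (B := FFB) (A' := FA) (B' := FB)
  (act_hom FA) (act_hom FB)) as [d [d1 d2]].
destruct (alg_prod_map (A := FFA) (B := FFB) (A' := FA) (B' := FB)
  (free_map (act A)) (free_map (act B))) as [n [n1 n2]].
destruct (biproduct_equations_natural HZ
  (alg_product (A := A) (B := B)) Hl Hk m1 m2)
  as [ml1 ml2].
destruct (biproduct_equations_natural HZ
  (alg_product (A := FA) (B := FB)) Hj Hl d1 d2)
  as [dj1 dj2].
destruct (biproduct_equations_natural HZ
  (alg_product (A := FA) (B := FB)) Hj Hl n1 n2)
  as [nj1 nj2].
pose proof (prod_unit_section (A := A) (B := B) m1 m2) as ms.
pose proof (prod_unit_section (A := FA) (B := FB) d1 d2) as ds.
pose proof (prod_unit_natural (A := A) (B := B) m1 m2 n1 n2) as ns.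
subst FA FB FFA FFB.
intros D f g.
destruct (Cl D (f ∘ act_hom A) (g ∘ act_hom B)) as [H [[H1 H2] _]].
(* On the coprojections [j1] and [j2] this reduces to the algebra law [act ∘ mu = act ∘ T act]. *)
assert (Hdn : H ∘ d = H ∘ n).
{ apply (coproduct_eq Cj); rewrite <- !comp_assoc.
  - rewrite dj1, nj1, !comp_assoc, H1, <- !comp_assoc; f_equal.
    apply alg_hom_eq, act_mu.
  - rewrite dj2, nj2, !comp_assoc, H2, <- !comp_assoc; f_equal.
    apply alg_hom_eq, act_mu. }
destruct (@alg_factor_split _ _ _ m (prod_unit A B) H ms) as [h hm].
(* With [s] and [s'] the units [eta × eta] at the two levels:
   [H ∘ s ∘ m = H ∘ n ∘ s' = H ∘ d ∘ s' = H]. *)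
{ apply alg_map_comp_eq in Hdn; simpl in *.
  now rewrite <- comp_assoc, ns, comp_assoc, <- Hdn, <- comp_assoc, ds, comp_idr. }
exists h; split.
- split; apply act_hom_epi; rewrite <- comp_assoc.
  + now rewrite <- ml1, comp_assoc, hm.
  + now rewrite <- ml2, comp_assoc, hm.
- intros h' [h1 h2].
  (* The composite with [m] is fixed by its values on [l1] and [l2], and [m] is split epi in [C]. *)
  assert (e : h ∘ m = h' ∘ m).
  { rewrite hm; apply (coproduct_eq Cl); rewrite <- comp_assoc, ?ml1, ?ml2,
      comp_assoc, ?h1, ?h2; trivial. }
  apply alg_hom_eq; apply alg_map_comp_eq in e.
  rewrite <- (comp_idr (alg_map h)), <- (comp_idr (alg_map h')).
  change (carrier (prod_alg P A B)) with (prod_ob P (carrier A) (carrier B)).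
  now rewrite <- ms, !comp_assoc, e.
Qed.

End Algebras.

(** * Additivity and biproducts in the Kleisli category *)

Section Additive.
Variables (C : category) (P : finite_products C) (S : finite_coproducts C).
Variable T : monad C.

Lemma one_final : is_final (one P).
Proof.
intros X; exists (bang P X); split; [trivial|]; intros; apply bang_eq.
Qed.

Lemma kleisli_zero_initial : is_initial (C := kleisli T) (zero S).
Proof.
intros X; exists (cobang S (T X)); split; [trivial|]; intros.
apply (@cobang_eq C S).
Qed.

(** Kleisli maps [X → 0] are maps [X → T 0] of [C], and initiality of [0] always carries over. *)
Lemma kleisli_zero_object :
  is_zero_object (C := kleisli T) (zero S) <-> is_final (T (zero S)).
Proof.
split; [exact (@proj2 _ _)|]; intros H; split; [apply kleisli_zero_initial|].
exact H.
Qed.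

Lemma zero_final_iso :
  is_final (T (zero S)) <-> exists u : hom (one P) (T (zero S)), is_iso u.
Proof.
split.
- intros H; destruct (H (one P)) as [u _]; exists u.
  now apply final_final_iso; [apply one_final|].
- intros [u Hu]; exact (final_iso Hu one_final).
Qed.

Lemma kleisli_comp_J (X Y Z : C) (g : hom Y (T Z)) (f : hom X Y) :
  @comp (kleisli T) X Y Z g (fmap (kleisli_J T) f) = g ∘ f.
Proof.
simpl; unfold kleisli_comp, kleisli_J_map.
now rewrite comp_assoc, <- (comp_assoc (mu T Z)), <- eta_nat, comp_assoc,
  mu_eta, comp_idl.
Qed.

Lemma kleisli_J_compl (X Y Z : C) (g : hom Y Z) (f : hom X (T Y)) :
  @comp (kleisli T) X Y Z (fmap (kleisli_J T) g) f = fmap T g ∘ f.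
Proof.
simpl; unfold kleisli_comp, kleisli_J_map.
now rewrite fmap_comp, comp_assoc, mu_fmap_eta, comp_idl.
Qed.

Lemma kleisli_coproduct (X Y : C) :
  is_coproduct (C := kleisli T) (A1 := X) (A2 := Y) (S := sum_ob S X Y)
    (fmap (kleisli_J T) (in1 S X Y)) (fmap (kleisli_J T) (in2 S X Y)).
Proof.
intros D f g; exists (copair S f g); split.
- rewrite !kleisli_comp_J; split;
    [apply (copair_in1 S (Z := T D)) | apply (copair_in2 S (Z := T D))].
- intros h; rewrite !kleisli_comp_J; intros [<- <-].
  symmetry; apply (copair_unique (Z := T D)).
Qed.

(** Kleisli composition with [p1] is composition in [C] with [mu ∘ T p1], and likewise for [p2]. So
    the universal property says that composing with the paired map is a bijection from maps
    [Z → T W] to maps [Z → T X × T Y], for every [Z]. *)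
Lemma kleisli_product_iff (X Y W : C)
    (p1 : @hom (kleisli T) W X) (p2 : @hom (kleisli T) W Y) :
  is_product (C := kleisli T) p1 p2 <->
  is_iso (pair P (mu T X ∘ fmap T p1) (mu T Y ∘ fmap T p2)).
Proof.
set (m := pair P _ _).
assert (e1 : mu T X ∘ fmap T p1 = pr1 P _ _ ∘ m) by (symmetry; apply pr1_pair).
assert (e2 : mu T Y ∘ fmap T p2 = pr2 P _ _ ∘ m) by (symmetry; apply pr2_pair).
clearbody m; unfold is_product; simpl; unfold kleisli_comp; rewrite e1, e2.
split.
- intros H; apply iso_of_bijective_post; intros Z f.
  destruct (H Z (pr1 P _ _ ∘ f) (pr2 P _ _ ∘ f)) as [h [[h1 h2] Hu]].
  exists h; split.
  + apply (@pair_ext C P); now rewrite comp_assoc.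
  + intros h' <-; apply Hu; now rewrite !comp_assoc.
- intros [n [nm mn]] Z f g.
  exists (n ∘ pair P f g); split.
  + split; rewrite comp_assoc, <- (comp_assoc _ m), mn, comp_idr;
      [apply pr1_pair | apply pr2_pair].
  + intros h [<- <-].
    rewrite <- !comp_assoc, <- pair_unique, comp_assoc, nm; apply comp_idl.
Qed.

Section ZeroMap.
Variable u : hom (one P) (T (zero S)).
Hypothesis Hu : is_iso u.

Lemma kleisli_zero_map (X Y : C) :
  is_zero_map (C := kleisli T) (zero S) (zero_map u X Y : @hom (kleisli T) X Y).
Proof.
exists (u ∘ bang P X), (fmap (kleisli_J T) (cobang S Y)).
rewrite kleisli_J_compl; unfold zero_map; symmetry; apply (@comp_assoc C).
Qed.

(** The equations prescribe [p1] and [p2] on both coprojections, as [eta] or as a zero map, and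
    hence determine them as copairings. *)
Lemma kleisli_bc_equations (X Y : C)
    (p1 : hom (sum_ob S X Y) (T X)) (p2 : hom (sum_ob S X Y) (T Y)) :
  biproduct_equations (C := kleisli T) (A1 := X) (A2 := Y) (S := sum_ob S X Y)
    (zero S) p1 p2
    (fmap (kleisli_J T) (in1 S X Y)) (fmap (kleisli_J T) (in2 S X Y)) <->
  p1 = bc_p1 u X Y /\ p2 = bc_p2 u X Y.
Proof.
unfold biproduct_equations; rewrite !kleisli_comp_J; split.
- assert (HZ : is_zero_object (C := kleisli T) (zero S)).
  { apply kleisli_zero_object, zero_final_iso; now exists u. }
  intros [e11 [e22 [z1 z2]]]; split; apply (@copair_ext C S).
  + rewrite e11; symmetry; apply copair_in1.
  + rewrite (zero_map_eq HZ z2 (kleisli_zero_map Y X)).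
    symmetry; apply copair_in2.
  + rewrite (zero_map_eq HZ z1 (kleisli_zero_map X Y)).
    symmetry; apply copair_in1.
  + rewrite e22; symmetry; apply copair_in2.
- intros [-> ->]; unfold bc_p1, bc_p2.
  rewrite !copair_in1, !copair_in2.
  repeat split; apply kleisli_zero_map.
Qed.

End ZeroMap.

Lemma additive_kleisli : additive P S T <-> kleisli_biproducts S T.
Proof.
split.
- intros [u [Hu Hbc]].
  assert (HZ : is_zero_object (C := kleisli T) (zero S)).
  { apply kleisli_zero_object, zero_final_iso; now exists u. }
  split; [exact HZ|]; intros X Y.
  exists (bc_p1 u X Y), (bc_p2 u X Y).
  split; [exact HZ|]; split; [apply kleisli_product_iff, Hbc|].
  split; [apply kleisli_coproduct|].
  now apply (kleisli_bc_equations Hu).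
- intros [HZ H].
  destruct (proj1 zero_final_iso (proj1 kleisli_zero_object HZ)) as [u Hu].
  exists u; split; [exact Hu|]; intros X Y.
  destruct (H X Y) as [p1 [p2 [_ [HP [_ E]]]]].
  (* Once the projections are [bc_p1] and [bc_p2], the comparison map of [kleisli_product_iff] is
     [bc] itself. *)
  apply (kleisli_bc_equations Hu) in E; destruct E as [-> ->].
  now apply kleisli_product_iff in HP.
Qed.

(** * Additivity and biproducts in the category of algebras *)

Lemma one_alg_zero_object :
  is_zero_object (one_alg T P) <->
  exists u : hom (one P) (T (zero S)), is_iso u.
Proof.
split.
(* The free algebra on [0] is initial, so an initial [one_alg] is isomorphic to it, and the
   underlying map is the required [u]. *)
- intros [HI _]; destruct (HI (free_alg T (zero S))) as [u _].
  exists (alg_map u); apply (alg_map_iso (f := u)).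
  apply (initial_initial_iso u HI (free_zero_initial S)).
- intros [u Hu]; split; [|apply one_alg_final].
  destruct (one_alg_final P (free_alg T (zero S))) as [b _].
  apply (initial_iso (m := b)); [|apply free_zero_initial].
  (* Only an inverse in [C] has to be given, since the forgetful functor reflects isomorphisms. *)
  apply alg_iso; exists u; split; [|apply (@bang_eq C P)].
  apply final_eq, zero_final_iso; exists u; exact Hu.
Qed.

(** The components of [bc] are the free extensions of [bc_p1] and [bc_p2], hence homomorphisms. *)
Lemma bc_act (u : hom (one P) (T (zero S))) (X Y : C) :
  bc u X Y ∘ mu T (sum_ob S X Y) =
  prod_act P (free_alg T X) (free_alg T Y) ∘ fmap T (bc u X Y).
Proof.
apply (@pair_ext C P); rewrite !comp_assoc; unfold bc.
- rewrite pr1_act, pr1_pair; simpl.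
  rewrite <- (comp_assoc _ (fmap T (pr1 P _ _))), <- fmap_comp, pr1_pair.
  apply (free_ext_act (A := free_alg T X)).
- rewrite pr2_act, pr2_pair; simpl.
  rewrite <- (comp_assoc _ (fmap T (pr2 P _ _))), <- fmap_comp, pr2_pair.
  apply (free_ext_act (A := free_alg T Y)).
Qed.

Definition bc_hom (u : hom (one P) (T (zero S))) (X Y : C) :
    hom (free_alg T (sum_ob S X Y)) (prod_alg P (free_alg T X) (free_alg T Y)) :=
  @AlgHom C T (free_alg T (sum_ob S X Y))
    (prod_alg P (free_alg T X) (free_alg T Y)) (bc u X Y) (bc_act u X Y).

Lemma free_ext_zero_map (u : hom (one P) (T (zero S))) (X Y : C) :
  is_iso u ->
  is_zero_map (one_alg T P) (free_ext (A := free_alg T Y) (zero_map u X Y)).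
Proof.
intros Hu; destruct (proj2 one_alg_zero_object (ex_intro _ u Hu)) as [HI _].
destruct (one_alg_final P (free_alg T X)) as [a _].
destruct (HI (free_alg T Y)) as [b _].
exists a, b; apply free_hom_eq; rewrite free_ext_eta; simpl.
destruct (HI (free_alg T (zero S))) as [w _].
(* Routing [b] through [T 0] leaves two maps [X → T 0] to compare, and [T 0] is final. *)
assert (e : b = free_map T (cobang S Y) ∘ w) by now apply initial_eq.
rewrite e; simpl; unfold zero_map.
rewrite <- !comp_assoc; f_equal.
apply final_eq, zero_final_iso; now exists u.
Qed.

(** Each component is the free extension of [bc_p1] or [bc_p2] restricted to one summand, so of
    [eta] or of a zero map. *)
Lemma bc_hom_equations (u : hom (one P) (T (zero S))) (X Y : C) :
  is_iso u ->
  biproduct_equations (one_alg T P)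
    (alg_pr1 P (free_alg T X) (free_alg T Y))
    (alg_pr2 P (free_alg T X) (free_alg T Y))
    (bc_hom u X Y ∘ free_map T (in1 S X Y))
    (bc_hom u X Y ∘ free_map T (in2 S X Y)).
Proof.
intros Hu.
assert (e1 : alg_pr1 P (free_alg T X) (free_alg T Y) ∘ bc_hom u X Y =
  free_ext (A := free_alg T X) (bc_p1 u X Y)) by apply alg_hom_eq, pr1_pair.
assert (e2 : alg_pr2 P (free_alg T X) (free_alg T Y) ∘ bc_hom u X Y =
  free_ext (A := free_alg T Y) (bc_p2 u X Y)) by apply alg_hom_eq, pr2_pair.
assert (E : forall (Z W : C) (A : Alg T) (f : hom Z W) (g : hom W (carrier A)),
  free_ext g ∘ free_map T f = free_ext (g ∘ f)).
{ intros Z W A f g; apply alg_hom_eq; simpl.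
  now rewrite fmap_comp, comp_assoc. }
unfold biproduct_equations; rewrite !comp_assoc, e1, e2, !E.
unfold bc_p1, bc_p2; rewrite !copair_in1, !copair_in2.
repeat split; try now apply free_ext_zero_map.
- apply alg_hom_eq, mu_fmap_eta.
- apply alg_hom_eq, mu_fmap_eta.
Qed.

(** By uniqueness the coprojections into the product must be [bc ∘ T in1] and [bc ∘ T in2]. As
    [T in1] and [T in2] form a coproduct, these do too exactly when [bc] is invertible. *)
Lemma bc_iso_iff (u : hom (one P) (T (zero S))) (X Y : C) :
  is_iso u ->
  is_iso (bc u X Y) <-> prod_coproduct P (free_alg T X) (free_alg T Y).
Proof.
intros Hu; pose proof (bc_hom_equations X Y Hu) as Hbc.
pose proof (proj2 one_alg_zero_object (ex_intro _ u Hu)) as HZ.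
split.
- intros Hi k1 k2 Hk.
  destruct (biproduct_equations_unique HZ
    (alg_product P (A := _) (B := _)) Hbc Hk) as [<- <-].
  apply coproduct_iso; [now apply alg_iso | apply free_coproduct].
- intros HC; apply (alg_map_iso (f := bc_hom u X Y)).
  apply (coproduct_coproduct_iso (@free_coproduct C T S X Y)), HC, Hbc.
Qed.

Lemma additive_alg : additive P S T <-> alg_biproducts P T.
Proof.
split.
- intros [u [Hu Hbc]].
  pose proof (proj2 one_alg_zero_object (ex_intro _ u Hu)) as HZ.
  split; [exact HZ|]; intros A B.
  destruct (exists_biproduct_equations HZ (alg_product P (A := A) (B := B)))
    as [k1 [k2 Hk]].
  exists k1, k2; split; [exact HZ|]; split; [apply alg_product|].
  split; [|exact Hk].
  apply (prod_coproduct_of_free HZ); [|exact Hk].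
  intros X Y; now apply (bc_iso_iff X Y Hu).
- intros [HZ H].
  destruct (proj1 one_alg_zero_object HZ) as [u Hu].
  exists u; split; [exact Hu|]; intros X Y; apply (bc_iso_iff X Y Hu).
  (* The biproduct of the free algebras supplies one pair of coprojections, and uniqueness
     identifies any other pair with it. *)
  destruct (H (free_alg T X) (free_alg T Y)) as [k1 [k2 [_ [_ [HC Hk]]]]].
  intros l1 l2 Hl.
  destruct (biproduct_equations_unique HZ
    (alg_product P (A := _) (B := _)) Hk Hl) as [<- <-].
  exact HC.
Qed.

End Additive.

Theorem theorem19 (C : category) (P : finite_products C)
    (S : finite_coproducts C) (T : monad C) :
  (additive P S T <-> kleisli_biproducts S T) /\
  (kleisli_biproducts S T <-> alg_biproducts P T).
Proof.
split; [apply additive_kleisli|].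
apply (iff_trans (iff_sym (additive_kleisli P S T))), additive_alg.
Qed.
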